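(* Let $r\geq 3$ and let $p_1\ge p_2\ge \dots \ge p_r\geq 2$ be integers with $p_1\geq 4$. If $$p_1\geq 2r-3-\sum_{i=2}^r 3\left(\left\lceil\frac{p_i}{3}\right\rceil-\frac{p_i}{3} \right),$$ then $$R^{PM}(p_1, \dots, p_r)= p_1- (r-1) + \sum_{i=2}^{r}\left\lceil\frac{p_i}{3}\right\rceil.$$
   Context: A path-matching is a vertex-disjoint union of paths, each with at least 2 vertices; its order is the number of vertices it spans. An $r$-coloring of $K_n$ is an assignment of a color from $[r]=\{1,\dots,r\}$ to each edge of the complete graph $K_n$ (not necessarily proper, and not every color need be used). A path-matching of color $i$ is a path-matching that is a subgraph of $K_n$ all of whose edges have color $i$. For positive integers $r,p_1,\dots,p_r$, $R^{PM}(p_1,\dots,p_r)$ is the smallest positive integer $n$ such that in every $r$-coloring of the edges of $K_n$ there exists a path-matching of color $i$ and order at least $p_i$ for some $i\in[r]$. *)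

(* Defs.v *)
From mathcomp Require Import all_boot all_order all_algebra.

Set Implicit Arguments.
Unset Strict Implicit.
Unset Printing Implicit Defensive.

(* A coloring of K_n is a function on all subsets of 'I_n; only its values on
   the edges, i.e. the two-element subsets, are constrained or ever used. *)
Definition edge_coloring (r n : nat) (c : {set 'I_n} -> nat) : Prop :=
  forall e : {set 'I_n}, #|e| = 2 -> 1 <= c e <= r.

Definition color_class (n : nat) (c : {set 'I_n} -> nat) (i : nat) : rel 'I_n :=
  fun x y => (x != y) && (c [set x; y] == i).

(* A path is given by the sequence of its vertices; uniqueness of the entries
   of the concatenation says both that every path has no repeated vertex and
   that the paths are pairwise vertex-disjoint. *)
Definition path_matching (T : eqType) (e : rel T) (m : seq (seq T)) : bool :=
  [&& all (fun s => 2 <= size s) m, all (sorted e) m & uniq (flatten m)].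

Definition pm_order (T : Type) (m : seq (seq T)) : nat := size (flatten m).

(* Colors are 1, ..., r; values of p outside this range are irrelevant. *)
Definition pm_arrows (r : nat) (p : nat -> nat) (n : nat) : Prop :=
  forall c : {set 'I_n} -> nat, edge_coloring r c ->
  exists (i : nat) (m : seq (seq 'I_n)),
    [/\ 1 <= i <= r, path_matching (color_class c i) m & p i <= pm_order m].

(* R^PM(p_1, ..., p_r) = n *)
Definition is_RPM (r : nat) (p : nat -> nat) (n : nat) : Prop :=
  [/\ 0 < n, pm_arrows r p n &
      forall k : nat, 0 < k -> pm_arrows r p k -> n <= k].

(* Main.v *)
Require Import Defs.
From mathcomp Require Import all_boot all_order all_algebra.
From mathcomp Require Import zify lra.

(* Packing edges and paths on three vertices has an exact min-max: in any graph
   there are a path-matching m and vertex sets S, T such that m spans at least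
   3|S| + |T| vertices and every edge meets S or lies inside T.  If no color i
   has a path-matching of order p_i, this gives S_i, T_i with
   3|S_i| + |T_i| < p_i, and outside the union of the S_i the cliques on the T_i
   cover all edges of a complete graph on W.  Unless some T_i contains W, each
   vertex of W lies in at least two T_i; the bound on p_1 makes at least p_1 of
   them lie in exactly two.  The index pairs of the latter pairwise intersect,
   so either they share an index i and |T_i| >= p_1, or three of the T_i cover
   W twice; each outcome contradicts the size of W.

   For the lower bound, take a block of p_1 - 1 vertices and blocks of
   ceil(p_i / 3) - 1 vertices for i >= 2, and color each edge by the larger of
   its two block numbers. *)

Set Implicit Arguments.
Unset Strict Implicit.
Unset Printing Implicit Defensive.

(** * Star packings: moving one vertex between stars *)

Definition fiber (V : finType) (c : {ffun V -> V}) (x : V) : {set V} :=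
  [set y | c y == x].

(* Every vertex is sent to the centre of its star; a star is a single vertex
   (then uncovered), an edge, or a path on three vertices. *)
Definition star_packing (V : finType) (e : rel V) (c : {ffun V -> V}) : bool :=
  [forall v, [&& c (c v) == c v, (c v != v) ==> e v (c v) & #|fiber c v| <= 3]].

Definition covered (V : finType) (c : {ffun V -> V}) : {set V} :=
  [set v | 1 < #|fiber c (c v)|].

(** With [x = u] this frees [u] as a centre of its own; with another centre [x] it attaches [u] to
    the star at [x]. *)
Definition upd (V : finType) (c : {ffun V -> V}) (u x : V) : {ffun V -> V} :=
  [ffun y => if y == u then x else c y].

Lemma fiber_upd (V : finType) (c : {ffun V -> V}) (u x z : V) :
  fiber (upd c u x) z = if z == x then u |: fiber c z else fiber c z :\ u.
Proof.
apply/setP => y; rewrite !inE ffunE.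
case: (eqVneq z x) => [->|zx]; rewrite !inE; case: (eqVneq y u) => //= _.
  by rewrite eqxx.
by rewrite eq_sym (negbTE zx).
Qed.

Lemma star_packingP (V : finType) (e : rel V) (c : {ffun V -> V}) :
  star_packing e c ->
  [/\ forall v, c (c v) = c v, forall v, c v != v -> e v (c v)
    & forall v, #|fiber c v| <= 3].
Proof.
move=> /forallP pc; split=> v; case/and3P: (pc v) => // /eqP //.
by move=> _ /implyP.
Qed.

Lemma leaf_covered (V : finType) (e : rel V) (c : {ffun V -> V}) (v : V) :
  star_packing e c -> c v != v -> (v \in covered c) && (c v \in covered c).
Proof.
case/star_packingP => cc _ _ cv; rewrite !inE cc andbb.
apply/card_gt1P; exists v, (c v); rewrite !inE ?cc ?eqxx //.
by rewrite eq_sym.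
Qed.

Lemma uncoveredP (V : finType) (e : rel V) (c : {ffun V -> V}) (v : V) :
  star_packing e c -> v \notin covered c -> c v = v /\ fiber c v = [set v].
Proof.
move=> pc vc; have cv : c v = v.
  by apply/eqP; apply: contraNT vc => /(leaf_covered pc)/andP[].
split=> //; apply/eqP; rewrite eq_sym eqEcard sub1set inE cv eqxx /= cards1.
by move: vc; rewrite inE cv -leqNgt.
Qed.

(** An uncovered [u] is a single-vertex star, so moving it breaks no other star, and the star at [x]
    gains its second or third vertex. *)
Lemma star_packing_attach (V : finType) (e : rel V) (c : {ffun V -> V})
    (u x : V) :
  irreflexive e -> star_packing e c -> u \notin covered c -> e u x ->
  c x = x -> #|fiber c x| <= 2 ->
  star_packing e (upd c u x) /\
  covered (upd c u x) = u |: (x |: covered c).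
Proof.
move=> irr pc uc eux cx fx; have [cu fu] := uncoveredP pc uc.
have [cc ce c3] := star_packingP pc.
have ux : u != x by apply: contraTneq eux => ->; rewrite irr.
have uNim v : v != u -> c v != u.
  by apply: contraNneq => cv; rewrite -in_set1 -fu inE cv.
have u_f : u \notin fiber c x by rewrite inE cu.
split.
  apply/forallP => v; rewrite fiber_upd !ffunE.
  case: (eqVneq v u) => [->|vu]; apply/and3P; split.
  - by rewrite (eq_sym x) (negbTE ux) cx.
  - by rewrite eux implybT.
  - rewrite (negbTE ux); apply: leq_trans (c3 u).
    by apply: subset_leq_card; apply: subsetDl.
  - by rewrite (negbTE (uNim _ vu)) cc.
  - by apply/implyP => /ce.
  - case: (eqVneq v x) => [->|_]; first by rewrite cardsU1 u_f.
    by apply: leq_trans (c3 v); apply: subset_leq_card; apply: subsetDl.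
apply/setP => v; rewrite !inE ffunE fiber_upd.
case: (eqVneq v u) => [->|vu] /=.
  rewrite eqxx cardsU1 u_f add1n ltnS card_gt0.
  by apply/set0Pn; exists x; rewrite inE cx.
case: (eqVneq (c v) x) => [cvx|cvx].
  rewrite cvx cardsU1 u_f add1n ltnS card_gt0.
  have -> : fiber c x != set0 by apply/set0Pn; exists x; rewrite inE cx.
  case: (eqVneq v x) => //= vx.
  have: c v != v by rewrite cvx eq_sym.
  by move/(leaf_covered pc); rewrite !inE cvx => /andP[].
have -> : (v == x) = false by apply: contra_neqF cvx => /eqP->; rewrite cx.
suff -> : fiber c (c v) :\ u = fiber c (c v) by [].
apply/setDidPl; rewrite disjoint_sym disjoints1 inE cu eq_sym.
exact: uNim.
Qed.

(** Freeing the leaf [y] leaves its centre covered only if the star had three vertices; an edge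
    loses both ends. *)
Lemma star_packing_detach (V : finType) (e : rel V) (c : {ffun V -> V})
    (y : V) :
  star_packing e c -> c y != y ->
  [/\ star_packing e (upd c y y), fiber (upd c y y) y = [set y],
      forall z, z != y -> fiber (upd c y y) z = fiber c z :\ y &
      covered c :\ y :\: (if #|fiber c (c y)| == 3 then set0 else [set c y])
        \subset covered (upd c y y)].
Proof.
move=> pc yy; have [cc ce c3] := star_packingP pc.
have yNim v : c v != y by apply: contraNneq yy => cv; rewrite -{1}cv cc cv.
have fy : fiber c y = set0.
  by apply/setP => v; rewrite !inE (negbTE (yNim v)).
have fy' : fiber (upd c y y) y = [set y] by rewrite fiber_upd eqxx fy setU0.
have fz z : z != y -> fiber (upd c y y) z = fiber c z :\ y.
  by move=> zy; rewrite fiber_upd (negbTE zy).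
split=> //.
  apply/forallP => v; rewrite !ffunE.
  case: (eqVneq v y) => [->|vy]; first by rewrite !eqxx fy' cards1.
  rewrite (negbTE (yNim _)) cc eqxx /= fz //.
  apply/andP; split; first by apply/implyP => /ce.
  by apply: leq_trans (c3 v); apply: subset_leq_card; apply: subsetDl.
apply/subsetP => v; rewrite in_setD in_setD1 => /and3P[vD vy].
rewrite !inE ffunE (negbTE vy) fz // => cv.
case: (boolP (y \in fiber c (c v))) => [yv|yv]; last first.
  suff -> : fiber c (c v) :\ y = fiber c (c v) by [].
  by apply/setDidPl; rewrite disjoint_sym disjoints1.
move: (yv); rewrite inE => /eqP yv'.
have := cardsD1 y (fiber c (c v)); rewrite yv => E.
move: vD; rewrite yv' E; case: ifP => [/eqP|]; first lia.
move=> _; rewrite inE => vcv.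
apply/card_gt1P; exists v, (c v); split; rewrite ?in_setD1 ?vy ?yNim //=.
- by rewrite inE.
- by rewrite inE cc.
Qed.

(** * Maximum packings, exchanges and the resulting barrier *)

Definition max_packing (V : finType) (e : rel V) (c : {ffun V -> V}) : Prop :=
  star_packing e c /\
  forall c', star_packing e c' -> #|covered c'| <= #|covered c|.

(** Otherwise the packing could be enlarged: if [x] is the centre of a smaller star, attach [u] to
    it; if [x] is a leaf, free it and attach [u] to it, together with its old centre when their star
    was an edge. *)
Lemma max_packing_uncovered_nbr (V : finType) (e : rel V) (c : {ffun V -> V})
    (u x : V) :
  symmetric e -> irreflexive e -> max_packing e c ->
  u \notin covered c -> e u x -> #|fiber c x| = 3.
Proof.
move=> sym irr [pc cmax] uc eux; have [cc ce c3] := star_packingP pc.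
have ux : u != x by apply: contraTneq eux => ->; rewrite irr.
have [cu _] := uncoveredP pc uc.
have noaug c' : star_packing e c' -> u |: covered c \subset covered c' -> False.
  move=> pc' /subset_leq_card; rewrite cardsU1 uc.
  by have := cmax _ pc'; lia.
apply/eqP; apply: contraT => fx.
case: (eqVneq (c x) x) => [cx|cx].
  have fx2 : #|fiber c x| <= 2 by have := c3 x; lia.
  have [pc' E] := star_packing_attach irr pc uc eux cx fx2.
  by case: (noaug _ pc'); rewrite E; apply/setUS/subsetUr.
have [p1 f1 f1' s1] := star_packing_detach pc cx.
set c1 := upd c x x in p1 f1 f1' s1.
have c1x : c1 x = x by rewrite ffunE eqxx.
have c1u : c1 u = u by rewrite ffunE (negbTE ux).
have uz : u != c x.
  apply: contraNneq uc => ->; by case/andP: (leaf_covered pc cx).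
have uc1 : u \notin covered c1.
  rewrite inE c1u f1' // -leqNgt; have [_ ->] := uncoveredP pc uc.
  by rewrite -(cards1 u); apply/subset_leq_card/subsetDl.
case: (boolP (#|fiber c (c x)| == 3)) => f3.
  rewrite f3 in s1; have [|p2 E2] := star_packing_attach irr p1 uc1 eux c1x.
    by rewrite f1 cards1.
  case: (noaug _ p2); rewrite E2; apply/setUS/subsetP => v vc.
  rewrite in_setU1; case: eqVneq => //= vx.
  by apply: (subsetP s1); rewrite setD0 !inE vx /=; rewrite inE in vc.
rewrite (negbTE f3) in s1.
(* The star of [x] was an edge, so freeing [x] leaves the old centre alone. *)
have fz : #|fiber c1 (c x)| = 1.
  rewrite f1' //; have := cardsD1 x (fiber c (c x)).
  have := c3 (c x); rewrite inE eqxx.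
  have : (c x \in fiber c (c x) :\ x) by rewrite !inE cc cx eqxx.
  rewrite (cardsD1 (c x) (fiber c (c x) :\ x)) => ->.
  by move: f3; lia.
have c1z : c1 (c x) = c x by rewrite ffunE (negbTE cx) cc.
have zc1 : c x \notin covered c1 by rewrite inE c1z fz.
have ezx : e (c x) x by rewrite sym; apply: ce.
have [|p2 E2] := star_packing_attach irr p1 zc1 ezx c1x.
  by rewrite f1 cards1.
have xz : x != c x by rewrite eq_sym.
have c2x : upd c1 (c x) x x = x by rewrite ffunE (negbTE xz).
have f2 : #|fiber (upd c1 (c x) x) x| <= 2.
  by rewrite fiber_upd eqxx f1 cards2; case: (_ != _).
have uc2 : u \notin covered (upd c1 (c x) x).
  by rewrite E2 !in_setU1 negb_or uz negb_or ux.
have [p3 E3] := star_packing_attach irr p2 uc2 eux c2x f2.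
case: (noaug _ p3); rewrite E3 E2; apply/setUS/subsetP => v vc.
rewrite !in_setU1; case: eqVneq => //= vx; case: eqVneq => //= vz.
by apply: (subsetP s1); rewrite !inE vx vz /=; rewrite inE in vc.
Qed.

(* Satisfied by the move that frees a leaf y of a three-vertex star and attaches
   an uncovered neighbour of the centre instead. *)
Definition exchange (V : finType) (e : rel V) : rel {ffun V -> V} :=
  fun c c' =>
    [&& star_packing e c', #|covered c'| == #|covered c|,
        [forall x, (#|fiber c' x| == 3) == (#|fiber c x| == 3)] &
        [forall y, [|| c' y == c y, y \notin covered c | y \notin covered c']]].

(** The leaf [y] is freed and [u] takes its place at [x], so the covered set only trades [y] for
    [u]. *)
Lemma exchange_leaf (V : finType) (e : rel V) (c : {ffun V -> V})
    (u x y : V) :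
  irreflexive e -> star_packing e c -> u \notin covered c -> e u x ->
  #|fiber c x| = 3 -> c y = x -> y != x ->
  exists2 c', exchange e c c' & y \notin covered c'.
Proof.
move=> irr pc uc eux fx cy yx; have [cc ce c3] := star_packingP pc.
have cx : c x = x by rewrite -cy cc.
have cyy : c y != y by rewrite cy eq_sym.
have [cu fu] := uncoveredP pc uc.
have ux : u != x by apply: contraTneq eux => ->; rewrite irr.
have yc : y \in covered c by case/andP: (leaf_covered pc cyy).
have yu : y != u by apply: contraTneq yc => ->.
have [p1 f1 f1' s1] := star_packing_detach pc cyy.
rewrite cy fx eqxx setD0 in s1.
have c1u : upd c y y u = u by rewrite ffunE eq_sym (negbTE yu).
have c1x : upd c y y x = x by rewrite ffunE eq_sym (negbTE yx).
have uc1 : u \notin covered (upd c y y).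
  rewrite inE c1u f1' 1?eq_sym // fu -leqNgt -(cards1 u).
  exact/subset_leq_card/subsetDl.
have yc1 : y \notin covered (upd c y y).
  by rewrite inE ffunE eqxx f1 cards1.
have fx1 : #|fiber (upd c y y) x| = 2.
  rewrite f1' 1?eq_sym //; have := cardsD1 y (fiber c x).
  by rewrite inE cy eqxx fx => -[].
have [|p2 E2] := star_packing_attach irr p1 uc1 eux c1x; first by rewrite fx1.
have yc2 : y \notin covered (upd (upd c y y) u x).
  by rewrite E2 !in_setU1 negb_or yu negb_or yx.
exists (upd (upd c y y) u x) => //.
have E1 : x |: covered (upd c y y) = covered c :\ y.
  apply/eqP; rewrite eqEsubset; apply/andP; split; last first.
    by apply: subset_trans s1 _; apply: subsetUr.
  apply/subsetP => v; rewrite in_setU1 in_setD1 => /orP[/eqP->|vc1].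
    by rewrite eq_sym yx inE cx fx.
  have vy : v != y by apply: contraTneq vc1 => ->.
  rewrite vy; apply: contraTT vc1 => vc; have [cv fv] := uncoveredP pc vc.
  rewrite inE ffunE (negbTE vy) cv f1' // -leqNgt fv -(cards1 v).
  exact/subset_leq_card/subsetDl.
apply/and4P; split=> //.
- rewrite E2 E1 cardsU1 in_setD1 (negbTE uc) andbF /=.
  by rewrite (cardsD1 y (covered c)) yc.
- apply/forallP => z; rewrite fiber_upd; case: (eqVneq z x) => [->|zx].
    rewrite cardsU1 fx1 f1' 1?eq_sym // in_setD1 inE cu (negbTE ux) andbF.
    by rewrite fx.
  suff -> : #|fiber (upd c y y) z :\ u| == 3 = (#|fiber c z| == 3) by [].
  case: (eqVneq z y) => [->|zy].
    rewrite f1; have -> : fiber c y = set0.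
      apply/setP => v; rewrite !inE; apply: contra_neqF cyy => /eqP <-.
      by rewrite cc.
    have: #|[set y] :\ u| <= 1.
      by rewrite -(cards1 y); apply/subset_leq_card/subsetDl.
    by rewrite cards0; case: #|_| => [|[|]].
  rewrite f1' //; have -> : fiber c z :\ y = fiber c z.
    apply/setDidPl; rewrite disjoint_sym disjoints1 inE cy.
    by rewrite eq_sym.
  case: (eqVneq z u) => [->|zu].
    by rewrite fu setDv cards0 cards1.
  have -> // : fiber c z :\ u = fiber c z.
  apply/setDidPl; rewrite disjoint_sym disjoints1 inE cu.
  by rewrite eq_sym.
apply/forallP => v; rewrite !ffunE.
case: (eqVneq v u) => [->|_]; first by rewrite uc !orbT.
case: (eqVneq v y) => [->|_]; first by rewrite yc2 !orbT.
by rewrite eqxx.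
Qed.

(** An exchange changes the centre only of vertices uncovered before or after it, so a vertex
    covered throughout keeps its centre from [c0]. *)
Lemma connect_exchange (V : finType) (e : rel V) (c0 c : {ffun V -> V}) :
  max_packing e c0 -> connect (@exchange V e) c0 c ->
  [/\ max_packing e c, forall x, (#|fiber c x| == 3) = (#|fiber c0 x| == 3)
    & forall y, (forall d, connect (@exchange V e) c0 d -> y \in covered d) ->
        c y = c0 y].
Proof.
pose R := connect (@exchange V e) c0.
pose inv c := [/\ max_packing e c,
  forall x, (#|fiber c x| == 3) = (#|fiber c0 x| == 3)
  & forall y, (forall d, R d -> y \in covered d) -> c y = c0 y].
move=> m0 /connectP[s ps ->].
have: R c0 by apply: connect0.
have: inv c0 by [].
rewrite -/(inv _); move: (c0) ps => d.
elim: s d => [|d' s IH] d //= /andP[st ps] [[pd md] fd id] cd.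
have cd' := connect_trans cd (connect1 st).
case/and4P: st => p' /eqP k' /forallP f' /forallP i'.
apply: (IH d') => //; split.
- by split=> // c' pc'; rewrite k'; apply: md.
- by move=> x; rewrite (eqP (f' x)) fd.
- move=> y yc; rewrite -id //; case/or3P: (i' y) => [/eqP // | |].
    by rewrite yc.
  by rewrite yc.
Qed.

(** A decomposition in the style of Gallai and Edmonds: [I] collects the vertices left uncovered by
    some reachable packing, [S] their neighbours, and [T] all the rest. The stars of [c0] centred in
    [S] have three vertices each, all outside [T], and [c0] covers [T]. *)
Lemma max_packing_barrier (V : finType) (e : rel V) (c0 : {ffun V -> V}) :
  symmetric e -> irreflexive e -> max_packing e c0 ->
  exists S T : {set V}, 3 * #|S| + #|T| <= #|covered c0| /\
    forall x y, e x y -> [|| x \in S, y \in S | (x \in T) && (y \in T)].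
Proof.
move=> sym irr m0; have [p0 _] := m0; have [cc0 _ _] := star_packingP p0.
(* Exchanges never change the three-vertex centres, so S consists of centres in
   c0, and any leaf of c0 on them is freed by some sequence of exchanges. *)
pose I := [set v | [exists c, connect (@exchange V e) c0 c
                     && (v \notin covered c)]].
pose S := [set x | [exists u, (u \in I) && e u x]].
have notI y : y \notin I ->
    forall d, connect (@exchange V e) c0 d -> y \in covered d.
  rewrite inE negb_exists => /forallP yI d cd.
  by move: (yI d); rewrite cd negbK.
have SP x : x \in S -> exists c u,
    [/\ connect (@exchange V e) c0 c, u \notin covered c & e u x].
  rewrite inE => /existsP[u /andP[]]; rewrite inE => /existsP[c /andP[cc uc]] eux.
  by exists c, u.
have S3 x : x \in S -> #|fiber c0 x| = 3.
  case/SP=> c [u [cc uc eux]]; have [mc fc _] := connect_exchange m0 cc.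
  by apply/eqP; rewrite -fc (max_packing_uncovered_nbr sym irr mc uc eux).
have leafI y : c0 y \in S -> y != c0 y -> y \in I.
  move=> cy yx; apply: contraT => yI.
  case/SP: (cy) => c [u [cc uc eux]].
  have [mc fc ic] := connect_exchange m0 cc.
  (* A leaf that is never uncovered still hangs on the same centre in [c], where an exchange would
     free it. *)
  have cyE := ic y (notI y yI); have [pc _] := mc.
  have f3 := max_packing_uncovered_nbr sym irr mc uc eux.
  have [c' st yc'] := exchange_leaf irr pc uc eux f3 cyE yx.
  move: yI; rewrite inE negb_exists => /forallP /(_ c').
  by rewrite yc' (connect_trans cc (connect1 st)).
exists S, (~: (S :|: I)); split; last first.
  move=> x y exy; rewrite !in_setC !in_setU.
  have imp a b : e a b -> a \in I -> b \in S.
    by move=> eab aI; rewrite inE; apply/existsP; exists a; rewrite aI.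
  case: (boolP (x \in S)) => //= xS; case: (boolP (y \in S)) => //= yS.
  rewrite (contraNN (imp _ _ exy)) // (contraNN (imp y x _)) //.
  by rewrite sym.
pose P := [set y | c0 y \in S].
have PS : #|P| = 3 * #|S|.
  rewrite -sum1_card (partition_big c0 (mem S)) /=; last by move=> y; rewrite inE.
  rewrite mulnC -sum_nat_const; apply: eq_bigr => x xS.
  rewrite sum1dep_card -(S3 x xS); apply: eq_card => y; rewrite !inE.
  by case: eqP => [->|]; rewrite ?andbT ?andbF // -[RHS]/true; move: xS; rewrite inE.
have dPT : [disjoint P & ~: (S :|: I)].
  rewrite disjoints_subset; apply/subsetP => y; rewrite in_set setCK in_setU => yP.
  case: (eqVneq y (c0 y)) => [->|yx]; first by rewrite yP.
  by rewrite leafI // orbT.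
have /eqP <- : #|P :|: ~: (S :|: I)| == 3 * #|S| + #|~: (S :|: I)|.
  by rewrite -PS (leq_card_setU _ _).
apply: subset_leq_card; rewrite subUset; apply/andP; split; apply/subsetP => y.
  by rewrite in_set => yP; rewrite inE (S3 _ yP).
rewrite in_setC in_setU negb_or => /andP[_ yI].
by apply: notI.
Qed.

(** * From star packings to path-matchings *)

Lemma uniq_flatten_map (T U : eqType) (F : T -> seq U) (g : U -> T)
    (s : seq T) :
  uniq s -> {in s, forall x, uniq (F x)} ->
  {in s, forall x z, z \in F x -> g z = x} -> uniq (flatten (map F s)).
Proof.
elim: s => //= x s IH /andP[xs us] uF gF.
rewrite cat_uniq uF ?mem_head // IH //=; first last.
- by move=> y ys; apply: gF; rewrite inE ys orbT.
- by move=> y ys; apply: uF; rewrite inE ys orbT.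
rewrite andbT; apply/hasPn => z /flatten_mapP[y ys zy].
apply: contraNN xs => zx; have <- := gF x (mem_head _ _) z zx.
by rewrite (gF y) // inE ys orbT.
Qed.

Lemma star_packing_path_matching (V : finType) (e : rel V)
    (c : {ffun V -> V}) :
  symmetric e -> star_packing e c ->
  exists m, path_matching e m /\ pm_order m = #|covered c|.
Proof.
move=> sym pc; have [cc ce c3] := star_packingP pc.
pose C := [set x | 1 < #|fiber c x|].
(* The centre is listed second, so a star reads as a path [[:: a; x]] or [[:: a; x; b]]; the value
   [[::]] does not occur for [x] in [C]. *)
pose F x := if enum (fiber c x :\ x) is a :: s then [:: a, x & s] else [::].
have C1 x : x \in C -> c x = x.
  rewrite inE => /ltnW; rewrite card_gt0 => /set0Pn[y].
  by rewrite inE => /eqP <-; rewrite cc.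
have FP x : x \in C -> perm_eq (F x) (x :: enum (fiber c x :\ x)).
  move=> xC; have := cardsD1 x (fiber c x); rewrite [in x \in _]inE C1 // eqxx.
  rewrite /F => fE; have: 0 < #|fiber c x :\ x| by move: xC; rewrite inE fE.
  rewrite cardE.
  case: (enum _) => // a s _.
  by rewrite -[[:: a, x & s]]/([:: a] ++ [:: x] ++ s) perm_catCA.
have Fmem x : x \in C -> F x =i fiber c x.
  move=> xC y; rewrite (perm_mem (FP x xC)) inE mem_enum in_setD1.
  by case: eqVneq => // ->; rewrite inE C1 ?eqxx.
have Fsz x : x \in C -> size (F x) = #|fiber c x|.
  move=> xC; rewrite (perm_size (FP x xC)) /= -cardE (cardsD1 x (fiber c x)).
  by rewrite [in x \in _]inE C1 // eqxx.
have um : uniq (flatten (map F (enum C))).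
  apply: (@uniq_flatten_map _ _ _ c); first exact: enum_uniq.
    move=> x; rewrite mem_enum => xC; rewrite (perm_uniq (FP x xC)) /=.
    by rewrite enum_uniq mem_enum in_setD1 eqxx.
  by move=> x; rewrite mem_enum => xC z; rewrite Fmem // inE => /eqP.
exists (map F (enum C)); split; last first.
  rewrite /pm_order -(card_uniqP um); apply: eq_card => y; rewrite inE.
  apply/flatten_mapP/idP => [[x]|yc].
    by rewrite mem_enum => xC; rewrite Fmem // inE => /eqP ->; rewrite inE in xC.
  have yC : c y \in C by rewrite inE.
  by exists (c y); rewrite ?mem_enum // Fmem // inE.
apply/and3P; split=> //; apply/allP => s /mapP[x]; rewrite mem_enum => xC ->{s}.
  by rewrite Fsz //; rewrite inE in xC.
have := Fsz _ xC; have := c3 x.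
rewrite /F; case E: (enum _) => [|a s] //= c3x szF.
have aE : a \in enum (fiber c x :\ x) by rewrite E mem_head.
have eL y : y \in enum (fiber c x :\ x) -> e y x.
  rewrite mem_enum !inE => /andP[yx /eqP cy].
  by rewrite -cy ce // cy eq_sym.
rewrite eL //=; move: c3x; rewrite -szF; move: E.
case: s {szF} => [|b [|]] //= E _; rewrite andbT sym eL // E.
by rewrite inE mem_head orbT.
Qed.

Lemma path_matching_barrier (V : finType) (e : rel V) :
  symmetric e -> irreflexive e ->
  exists (m : seq (seq V)) (S T : {set V}),
    [/\ path_matching e m, 3 * #|S| + #|T| <= pm_order m &
     forall x y, e x y -> [|| x \in S, y \in S | (x \in T) && (y \in T)]].
Proof.
move=> sym irr.
(* The packing into single vertices shows that packings exist; a maximum one is then chosen. *)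
have p0 : star_packing e [ffun v => v].
  apply/forallP => v; rewrite !ffunE !eqxx /=.
  have -> : fiber [ffun v => v] v = [set v].
    by apply/setP => y; rewrite !inE ffunE.
  by rewrite cards1.
case: (arg_maxnP (fun c => #|covered c|) p0) => c pc cmax.
have [S [T [ST E]]] := max_packing_barrier sym irr (conj pc cmax).
have [m [pm om]] := star_packing_path_matching sym pc.
by exists m, S, T; rewrite om.
Qed.

(** * Covering a complete graph by cliques *)

(* The vertices lying in exactly two of the T i number at least
   3|W| - sum |T i|.  If x lies in T i and T j only, then T i and T j together
   contain W; so when the index pairs form a triangle {i, j}, {i, k}, {j, k},
   every vertex of W lies in two of T i, T j, T k. *)
Lemma clique_cover (V I : finType) (W : {set V}) (T : I -> {set V}) :
  1 < #|W| -> (forall i, T i \subset W) ->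
  (forall x y, x \in W -> y \in W -> x != y ->
     exists i, (x \in T i) && (y \in T i)) ->
  [\/ exists i, T i = W,
      exists i, 3 * #|W| <= \sum_j #|T j| + #|T i|
    | exists i j k, [/\ i != j, i != k, j != k &
        2 * #|W| <= #|T i| + #|T j| + #|T k|]].
Proof.
move=> W1 TW cov.
case: (boolP [exists i, T i == W]) => [/existsP[i /eqP]|nT].
  by constructor 1; exists i.
have {nT}Tn i : exists2 w, w \in W & w \notin T i.
  have /subsetPn[w] : ~~ (W \subset T i).
    apply: contraNN nT => WT; apply/existsP; exists i.
    by rewrite eqEsubset TW.
  by exists w.
pose N x := [set i | x \in T i].
(* For [x = y], cover an edge from [x] to another vertex of [W], which exists as [1 < #|W|]. *)
have cov' x y : x \in W -> y \in W -> exists i, (x \in T i) && (y \in T i).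
  move=> xW yW; case: (eqVneq x y) => [<-|]; last exact: cov.
  have /card_gt0P[z] : 0 < #|W :\ x| by move: (cardsD1 x W); rewrite xW; lia.
  rewrite in_setD1 => /andP[zx zW]; have [|i /andP[xi _]] := cov x z xW zW.
    by rewrite eq_sym.
  by exists i; rewrite xi.
have N2 x : x \in W -> 1 < #|N x|.
  move=> xW; have [i /andP[xi _]] := cov' x x xW xW.
  have [w wW wi] := Tn i; have [j /andP[xj wj]] := cov' x w xW wW.
  apply/card_gt1P; exists i, j; rewrite !inE; split=> //.
  by apply: contraNneq wi => ->.
have sumN : \sum_(x in W) #|N x| = \sum_j #|T j|.
  under eq_bigr => x _ do rewrite -sum1dep_card big_mkcond /=.
  rewrite exchange_big /=; apply: eq_bigr => j _.
  rewrite -big_mkcondr /= -sum1_card; apply: eq_bigl => x.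
  by case: (boolP (x \in T j)) => [/(subsetP (TW j)) ->|]; rewrite ?andbF.
pose Q := [set x in W | #|N x| == 2].
(* Each vertex of [W] is counted at least three times, the third time by [Q] if it lies in only two
   of the sets. *)
have QW : 3 * #|W| <= \sum_j #|T j| + #|Q|.
  have -> : #|Q| = \sum_(x in W) (#|N x| == 2).
    rewrite -sum1_card [LHS]big_mkcond [RHS]big_mkcond; apply: eq_bigr => x _.
    by rewrite !inE; case: (x \in W) => //=; case: (_ == 2).
  rewrite -sumN mulnC -sum_nat_const.
  rewrite -big_split /=; apply: leq_sum => x xW.
  by have := N2 x xW; case: eqP; lia.
have star i : (forall x, x \in Q -> x \in T i) ->
    3 * #|W| <= \sum_j #|T j| + #|T i|.
  move=> Qi; apply: leq_trans QW _; rewrite leq_add2l.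
  by apply/subset_leq_card/subsetP.
case: (set_0Vmem Q) => [Q0|[q qQ]].
  have [x xW] : exists x, x \in W by apply/card_gt0P; lia.
  have [i _] := cov' x x xW xW.
  by constructor 2; exists i; apply: star => y; rewrite Q0 inE.
have QP x : x \in Q -> exists i j, [/\ i != j, N x = [set i; j] & T i :|: T j = W].
  rewrite inE => /andP[xW /cards2P[i [j [ij Nx]]]]; exists i, j; split=> //.
  apply/eqP; rewrite eqEsubset subUset !TW /=; apply/subsetP => y yW.
  have [k /andP[xk yk]] := cov' x y xW yW.
  have : k \in N x by rewrite inE.
  by rewrite Nx !inE => /orP[] /eqP <-; rewrite yk ?orbT.
have QI x y : x \in Q -> y \in Q -> exists k, (k \in N x) && (k \in N y).
  rewrite !inE => /andP[xW _] /andP[yW _]; have [k kk] := cov' x y xW yW.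
  by exists k; rewrite !inE.
have [i [j [ij Nq Uij]]] := QP q qQ.
case: (boolP [forall x in Q, x \in T i]) => [/forall_inP Qi|].
  by constructor 2; exists i; apply: star.
case: (boolP [forall x in Q, x \in T j]) => [/forall_inP Qj _|].
  by constructor 2; exists j; apply: star.
(* The pair of [x] misses j and that of [y] misses i; since pairs meet, they are {i, k} and {j, l},
   and meeting each other forces k = l. *)
rewrite !negb_forall_in => /exists_inP[x xQ xj] /exists_inP[y yQ yi].
have xi : x \in T i.
  have [k] := QI q x qQ xQ; rewrite Nq !inE => /andP[/orP[]/eqP-> //].
  by rewrite (negbTE xj).
have yj : y \in T j.
  have [k] := QI q y qQ yQ; rewrite Nq !inE => /andP[/orP[]/eqP-> //].
  by rewrite (negbTE yi).
have other z a b : z \in Q -> z \in T a -> z \notin T b ->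
    exists k, [/\ k != a, k != b, N z = [set a; k] & T a :|: T k = W].
  move=> zQ za zb; have [k [l [kl Nz Ukl]]] := QP z zQ.
  have : a \in N z by rewrite inE.
  rewrite Nz !inE => /orP[]/eqP->.
    exists l; rewrite eq_sym kl; split=> //.
    apply: contraNneq zb => <-.
    have : l \in N z by rewrite Nz !inE eqxx orbT.
    by rewrite inE.
  exists k; rewrite kl setUC [T l :|: _]setUC; split=> //.
  apply: contraNneq zb => <-.
  have : k \in N z by rewrite Nz !inE eqxx.
  by rewrite inE.
have [k [ki kj Nx Uik]] := other x i j xQ xi xj.
have [l [lj li Ny Ujl]] := other y j i yQ yj yi.
have kl : k = l.
  have [h] := QI x y xQ yQ; rewrite Nx Ny !inE.
  case/andP=> /orP[]/eqP->.
    by rewrite (negbTE ij) eq_sym (negbTE li).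
  by rewrite (negbTE kj) => /eqP.
subst l; constructor 3; exists i, j, k.
rewrite ij eq_sym ki eq_sym kj; split=> //.
(* Inclusion-exclusion trades [T i] and [T j] for [W] and their intersection; the latter covers [W]
   together with [T k]. *)
have h a b : T a :|: T b = W -> #|T a| + #|T b| = #|W| + #|T a :&: T b|.
  by move=> <-; rewrite cardsUI.
have hij := h _ _ Uij; rewrite hij.
have : W \subset T k :|: (T i :&: T j).
  by rewrite setUIr setUC Uik setUC Ujl setIid.
move/subset_leq_card; move: (leq_card_setU (T k) (T i :&: T j)) => [].
by move=> h1 _ h2; lia.
Qed.

(** * Upper bound: counting in a coloring without large path-matchings *)

Lemma color_class_sym (n : nat) (c : {set 'I_n} -> nat) (i : nat) :
  symmetric (color_class c i).
Proof. by move=> x y; rewrite /color_class eq_sym setUC. Qed.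

Lemma color_class_irr (n : nat) (c : {set 'I_n} -> nat) (i : nat) :
  irreflexive (color_class c i).
Proof. by move=> x; rewrite /color_class eqxx. Qed.

Lemma leq_card_bigcup (V I : finType) (S : I -> {set V}) :
  #|\bigcup_i S i| <= \sum_i #|S i|.
Proof.
elim/big_rec2: _ => [|i m A _ IH]; first by rewrite cards0.
by apply: leq_trans (leq_card_setU _ _) _; rewrite leq_add2l.
Qed.

(** Excludes a single clique on all of [W]: the left side bounds [#|W|] from below, the right side
    from above. As p - ceil(p/3) is nondecreasing, [p] may be lowered to [q]. *)
Lemma ceil_third_gap (p q s : nat) :
  q <= p -> 3 * s < q -> p - (p + 2) %/ 3 + 1 + ((q + 2) %/ 3 - s.+1) > q.-1 - 3 * s.
Proof. by lia. Qed.

(** Excludes three cliques covering [W] twice: [w] is [#|W|], bounded below both by [p] and through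
    the slacks of the three colors. *)
Lemma ceil_third_gap3 (p q1 q2 q3 s1 s2 s3 t1 t2 t3 w : nat) :
  4 <= p -> p <= w -> q1 <= p -> q2 <= p -> q3 <= p ->
  3 * s1 + t1 < q1 -> 3 * s2 + t2 < q2 -> 3 * s3 + t3 < q3 ->
  p - (p + 2) %/ 3 + 1 + (((q1 + 2) %/ 3 - s1.+1) +
    (((q2 + 2) %/ 3 - s2.+1) + ((q3 + 2) %/ 3 - s3.+1))) <= w ->
  2 * w <= t1 + t2 + t3 -> False.
Proof. by lia. Qed.

Lemma leq_sum3 (I : finType) (F : I -> nat) (i j k : I) :
  i != j -> i != k -> j != k -> F i + (F j + F k) <= \sum_l F l.
Proof.
move=> ij ik jk; rewrite (bigD1 i) //= (bigD1 j) 1?eq_sym //= (bigD1 k) /=.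
  by rewrite !leq_add2l leq_addr.
by rewrite eq_sym ik eq_sym jk.
Qed.

(** The equation is n = p_1 - (r - 1) + sum over i >= 2 of ceil(p_i/3), with the term of color 1
    added on both sides and no subtraction. For this n the last inequality is the bound assumed on
    p_1. *)
Lemma pm_arrows_of_counts (r n : nat) (p : nat -> nat) :
  0 < r -> (forall i : 'I_r, p i.+1 <= p 1) -> 4 <= p 1 ->
  n + r + (p 1 + 2) %/ 3 = p 1 + 1 + \sum_(i < r) (p i.+1 + 2) %/ 3 ->
  \sum_(i < r) p i.+1 + p 1 <= 3 * n + r ->
  pm_arrows r p n.
Proof.
move=> r0 p1i p4 nE pn c cE.
have /fin_all_exists[f fP] : forall i : 'I_r, exists
    f : seq (seq 'I_n) * ({set 'I_n} * {set 'I_n}),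
    [/\ path_matching (color_class c i.+1) f.1,
        3 * #|f.2.1| + #|f.2.2| <= pm_order f.1
      & forall x y, color_class c i.+1 x y ->
          [|| x \in f.2.1, y \in f.2.1 | (x \in f.2.2) && (y \in f.2.2)]].
  move=> i; have [m [S [T mST]]] := path_matching_barrier
    (color_class_sym c i.+1) (color_class_irr c i.+1).
  by exists (m, (S, T)).
case: (boolP [exists i : 'I_r, p i.+1 <= pm_order (f i).1]).
  case/existsP=> i pi; exists i.+1, (f i).1; split; rewrite //=.
  by case: (fP i).
rewrite negb_exists => /forallP pf; exfalso.
pose S i := (f i).2.1; pose W := ~: \bigcup_i S i.
pose T i := (f i).2.2 :&: W.
have ST i : 3 * #|S i| + #|T i| < p i.+1.
  have [_ fi _] := fP i; move: (pf i); rewrite -ltnNge; apply: leq_trans.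
  rewrite ltnS; apply: leq_trans fi; rewrite leq_add2l.
  exact/subset_leq_card/subsetIl.
have wn : n <= #|W| + \sum_i #|S i|.
  have := leq_card_bigcup S; have := cardsC (\bigcup_i S i).
  rewrite -/W card_ord; move: #|_| #|_| (\sum_i _) => a b d; lia.
(* The slack of color i; the subtraction is exact because 3|S_i| < p_i. *)
pose D i := (p (i : 'I_r).+1 + 2) %/ 3 - #|S i|.+1.
have DE : \sum_i D i + (\sum_i #|S i| + r) = \sum_(i < r) (p i.+1 + 2) %/ 3.
  have -> : \sum_i #|S i| + r = \sum_i #|S i|.+1.
    under [RHS]eq_bigr => i _ do rewrite -addn1.
    by rewrite big_split /= sum1_card card_ord.
  rewrite -big_split; apply: eq_bigr => i _ /=; rewrite subnK //.
  by move: (ST i); move: #|S i| #|T i| => s t; lia.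
have sumST : 3 * \sum_i #|S i| + \sum_i #|T i| + r <= \sum_(i < r) p i.+1.
  have rE : \sum_(i < r) 1 = r by rewrite sum1_card card_ord.
  rewrite -[X in _ + X <= _]rE.
  rewrite big_distrr /= -!big_split /=; apply: leq_sum => i _.
  by rewrite addn1.
have wD : p 1 - (p 1 + 2) %/ 3 + 1 + \sum_i D i <= #|W|.
  move: DE wn nE; move: #|W| (\sum_i D i) (\sum_i #|S i|) => w d s.
  by move: (\sum_(i < r) _) => z; lia.
have W1 : 1 < #|W| by move: wD; move: #|W| (\sum_i D i) => w d; lia.
have TW i : T i \subset W by apply: subsetIr.
have covW x y : x \in W -> y \in W -> x != y ->
    exists i, (x \in T i) && (y \in T i).
  move=> xW yW xy.
  have /andP[c1 cr] : 1 <= c [set x; y] <= r by apply: cE; rewrite cards2 xy.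
  have ci : (c [set x; y]).-1 < r by rewrite prednK.
  exists (Ordinal ci); have [_ _ /(_ x y)] := fP (Ordinal ci).
  rewrite /color_class /= prednK // xy eqxx => /(_ isT).
  have nS z : z \in W -> z \notin S (Ordinal ci).
    by rewrite inE; apply: contraNN => zS; apply/bigcupP; exists (Ordinal ci).
  by rewrite (negbTE (nS _ xW)) (negbTE (nS _ yW)) !in_setI /= xW yW !andbT.
case: (clique_cover W1 TW covW) => [[i TiW]|[i wi]|[i [j [k [ij ik jk wT]]]]].
- have Di : D i <= \sum_j D j by rewrite (bigD1 i) //= leq_addr.
  have := ST i; rewrite TiW => Si.
  have := @ceil_third_gap (p 1) (p i.+1) #|S i| (p1i i)
    (leq_ltn_trans (leq_addr _ _) Si).
  rewrite -/(D i); move: wD Di Si; move: #|W| #|S i| => w s.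
  by move: (D i) (\sum_j D j) => d d'; lia.
(* Adding up gives p_1 <= 3|W| - sum |T_j| <= |T_i|, against |T_i| < [p i.+1] <= p_1. *)
- move: (ST i) sumST wn pn wi (p1i i).
  move: #|T i| #|S i| #|W| (\sum_i #|S i|) (\sum_i #|T i|) => t s w ss ts.
  by move: (\sum_(i < r) _) => sp; lia.
have T3 := leq_sum3 (fun i => #|T i|) ij ik jk.
have D3 := leq_sum3 D ij ik jk.
apply: (ceil_third_gap3 p4 _ (p1i i) (p1i j) (p1i k) (ST i) (ST j) (ST k) _ wT).
  (* The three cliques have total size at least 2|W|, so the same count gives p_1 <= |W|. *)
  move: sumST wn pn wT; move: T3; rewrite addnA.
  move: (#|T i| + _ + _) #|W| (\sum_i #|S i|) (\sum_i #|T i|) => t w ss ts.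
  by move: (\sum_(i < r) _) => sp; lia.
by apply: leq_trans wD; rewrite leq_add2l.
Qed.

(** * Lower bound: the coloring by blocks *)

Lemma path_cover_size (T : eqType) (e : rel T) (B : pred T) (x : T) (s : seq T) :
  (forall y z, e y z -> B y || B z) -> path e x s ->
  size s <= 2 * count B s + B x.
Proof.
move=> eB; elim: s x => //= y s IH x /andP[/eB exy /IH].
by case: (B x) (B y) exy => [] [] //=; lia.
Qed.

(** A path with an edge meets [B], and no two consecutive vertices avoid it; the extreme case is a
    path on three vertices with only the middle one in [B]. *)
Lemma sorted_cover_size (T : eqType) (e : rel T) (B : pred T) (s : seq T) :
  (forall y z, e y z -> B y || B z) -> sorted e s -> 2 <= size s ->
  size s <= 3 * count B s.
Proof.
move=> eB; case: s => [|x [|y s]] //= /andP[/eB exy] /(path_cover_size eB).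
by case: (B x) (B y) exy => [] [] //=; lia.
Qed.

Lemma pm_order_cover (T : eqType) (e : rel T) (B : pred T) (m : seq (seq T)) :
  (forall y z, e y z -> B y || B z) -> path_matching e m ->
  pm_order m <= 3 * count B (flatten m).
Proof.
move=> eB /and3P[+ + _]; rewrite /pm_order; elim: m => //= s m IH.
move=> /andP[s2 m2] /andP[ss ms]; rewrite size_cat count_cat mulnDr.
by apply: leq_add; [apply: sorted_cover_size ss s2 | apply: IH].
Qed.

Lemma pm_order_within (T : eqType) (e : rel T) (B : pred T) (m : seq (seq T)) :
  (forall y z, e y z -> B y && B z) -> path_matching e m ->
  pm_order m <= count B (flatten m).
Proof.
move=> eB /and3P[+ + _]; rewrite /pm_order; elim: m => //= s m IH.
move=> /andP[s2 m2] /andP[ss ms]; rewrite size_cat count_cat.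
apply: leq_add; last exact: IH.
suff: all B s by rewrite all_count => /eqP ->.
move: ss s2; case: s => [|x [|y s]] //= /andP[exy ps] _.
have /andP[-> By] := eB _ _ exy; rewrite By /=.
elim: s y ps {exy By} => //= z s IHs y /andP[/eB/andP[_ ->]].
exact: IHs.
Qed.

(** Distinct ordinals read distinct positions of [L]; as [n <= size L], the default [k] is never
    read. *)
Lemma count_ord_nth (n k : nat) (L : seq nat) (a : pred nat) (s : seq 'I_n) :
  uniq s -> n <= size L -> count (fun x : 'I_n => a (nth k L x)) s <= count a L.
Proof.
move=> us nL; pose s' := [seq x <- s | a (nth k L (x : 'I_n))].
rewrite -size_filter -/s'.
have -> : count a L = size [seq j <- iota 0 (size L) | a (nth k L j)].
  by rewrite size_filter -[in LHS](mkseq_nth k L) /mkseq count_map.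
rewrite -(size_map val s'); apply: uniq_leq_size.
  by rewrite (map_inj_uniq val_inj) filter_uniq.
move=> j /mapP[x]; rewrite !mem_filter mem_iota => /andP[ax _] ->.
by rewrite ax /= add0n (leq_trans (ltn_ord x) nL).
Qed.

(* [L] lists the block number of each vertex. *)
Lemma not_pm_arrows_blocks (r n : nat) (p : nat -> nat) (L : seq nat) :
  all (fun i => 1 <= i <= r) L -> n <= size L ->
  count_mem 1 L < p 1 ->
  (forall i, 1 < i <= r -> 3 * count_mem i L < p i) ->
  ~ pm_arrows r p n.
Proof.
move=> /allP L1r nL p1 pi arr.
pose g (x : 'I_n) := nth 0 L x.
have g1r x : 1 <= g x <= r by apply/L1r/mem_nth/(leq_trans (ltn_ord x)).
pose c (e : {set 'I_n}) := \max_(x in e) g x.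
have cE x y : x != y -> c [set x; y] = maxn (g x) (g y).
  by move=> xy; rewrite /c big_setU1 ?inE //= big_set1.
have cok : edge_coloring r c.
  move=> e /eqP/cards2P[x [y [xy ->]]]; rewrite cE //.
  by have := g1r x; have := g1r y; case: (leqP (g x) (g y)).
have [i [m [i1r pm om]]] := arr c cok; have /and3P[_ _ um] := pm.
case: (eqVneq i 1) om pm => [->|i1] om pm.
  (* Block numbers are at least 1, so an edge with maximum 1 lies inside block 1. *)
  have := @pm_order_within _ _ (fun x => g x == 1) _ _ pm.
  have := @count_ord_nth n 0 L (pred1 1) _ um nL.
  move=> h1 h2; suff: p 1 <= count_mem 1 L by rewrite leqNgt p1.
  apply: leq_trans om (leq_trans (h2 _) h1) => x y /andP[xy]; rewrite cE //.
  by move: (g x) (g y) (g1r x) (g1r y) => a b; lia.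
(* The maximum is attained at an end, so every edge of color [i] meets block [i]. *)
have := @pm_order_cover _ _ (fun x => g x == i) _ _ pm.
have := @count_ord_nth n 0 L (pred1 i) _ um nL.
move=> h1 h2; have /pi : 1 < i <= r by move: i1r i1; lia.
suff : p i <= 3 * count_mem i L by rewrite leqNgt => /negbTE ->.
apply: leq_trans om (leq_trans (h2 _) _); last by rewrite leq_mul2l h1.
move=> x y /andP[xy]; rewrite cE //.
by case: leqP => _ /eqP ->; rewrite eqxx ?orbT.
Qed.

(** The largest b with 3b < p_i is ceil(p_i/3) - 1. Blocks of these sizes, and one of size p_1 - 1,
    have enough vertices for every [n] below the bound. *)
Lemma ltn_RPM_blocks (r n : nat) (p : nat -> nat) :
  0 < p 1 -> (forall i, 1 < i <= r -> 0 < p i) -> 0 < r ->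
  n < p 1 + \sum_(2 <= i < r.+1) ((p i + 2) %/ 3).-1 ->
  ~ pm_arrows r p n.
Proof.
move=> p1 pi r0 nlt; pose F i := nseq ((p i + 2) %/ 3).-1 i.
pose L := nseq (p 1).-1 1 ++ flatten (map F (index_iota 2 r.+1)).
have cL i : count_mem i (flatten (map F (index_iota 2 r.+1))) =
    (1 < i <= r) * ((p i + 2) %/ 3).-1.
  rewrite count_flatten sumnE !big_map.
  under eq_bigr => j _ do rewrite count_nseq /=.
  case: (boolP (1 < i <= r)) => ir; last first.
    rewrite big_seq big1 // => j; rewrite mem_index_iota ltnS => jr.
    by case: eqVneq => // ji; rewrite -ji jr in ir.
  rewrite (bigD1_seq i) ?iota_uniq //= ?mem_index_iota // eqxx.
  by rewrite big1 ?addn0 // => j /negbTE ->.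
apply: (@not_pm_arrows_blocks r n p L).
- rewrite all_cat all_nseq r0 orbT /=; apply/allP => i.
  move=> /flatten_mapP[j]; rewrite mem_index_iota ltnS => /andP[j1 jr].
  by rewrite mem_nseq => /andP[_ /eqP ->]; rewrite (ltnW j1).
- rewrite size_cat size_nseq size_flatten /shape sumnE !big_map.
  under eq_bigr => j _ do rewrite size_nseq.
  by move: nlt p1; move: (\sum_(_ <= _ < _) _) => s; lia.
- by rewrite count_cat count_nseq cL /= mul1n addn0 prednK.
- move=> i ir; rewrite count_cat count_nseq cL ir /=.
  have -> : (1 == i) = false by lia.
  by have := pi i ir; lia.
Qed.

(** * Rational ceilings and the final assembly *)

Import Order.TTheory GRing.Theory Num.Theory.
Local Open Scope ring_scope.

Lemma ceil_third (n : nat) :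
  Num.ceil (n%:R / 3 : rat) = ((n + 2) %/ 3)%N%:Z.
Proof.
apply: ceil_def.
have : ((n + 2) %/ 3 * 3 <= n + 2)%N by apply: leq_trunc_div.
have : (n <= (n + 2) %/ 3 * 3)%N by lia.
rewrite intrD -pmulrn; move: ((_ + _) %/ _)%N => m.
rewrite -!(ler_nat rat) !natrD !natrM.
by move=> h1 h2; apply/andP; split; lra.
Qed.

Theorem theorem1p2 (r : nat) (p : nat -> nat)
  (hr : (3 <= r)%N)
  (p_noninc : forall i j : nat, (1 <= i)%N -> (i <= j)%N -> (j <= r)%N ->
     (p j <= p i)%N)
  (hpr : (2 <= p r)%N)
  (hp1 : (4 <= p 1%N)%N)
  (hp : (p 1%N)%:R >=
     2 * r%:R - 3
     - \sum_(2 <= i < r.+1)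
         3 * ((Num.ceil ((p i)%:R / 3 : rat))%:~R - (p i)%:R / 3) :> rat) :
  exists n : nat,
    is_RPM r p n /\
    n%:Z = (p 1%N)%:Z - (r%:Z - 1)
           + \sum_(2 <= i < r.+1) Num.ceil ((p i)%:R / 3 : rat).
Proof.
have p2 i : (0 < i <= r -> 2 <= p i)%N.
  by case/andP=> i0 ir; apply: leq_trans hpr (p_noninc _ _ i0 ir (leqnn r)).
(* [A] sums the ceilings and [A'] the block sizes; the 1 subtracted in each of the r - 1 terms
   accounts for -(r - 1) in the formula. *)
pose A := (\sum_(2 <= i < r.+1) (p i + 2) %/ 3)%N.
pose A' := (\sum_(2 <= i < r.+1) ((p i + 2) %/ 3).-1)%N.
have AA' : (A' + r.-1 = A)%N.
  have -> : r.-1 = (\sum_(2 <= i < r.+1) 1)%N.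
    by rewrite sum_nat_const_nat muln1; lia.
  rewrite -big_split big_seq [RHS]big_seq; apply: eq_bigr => i /=.
  rewrite mem_index_iota => ir; have := p2 i; lia.
have sumE (F : nat -> nat) :
    (\sum_(i < r) F i.+1 = F 1 + \sum_(2 <= i < r.+1) F i)%N.
  by rewrite -big_ltn ?big_add1 ?big_mkord //=; lia.
(* The bound on p_1 cleared of fractions, as 3(ceil(p_i/3) - p_i/3) = 3 ceil(p_i/3) - p_i. *)
have hpN : (2 * r + \sum_(2 <= i < r.+1) p i <= p 1 + 3 + 3 * A)%N.
  rewrite -(ler_nat rat) [leLHS]natrD [leRHS]natrD [(p 1 + 3)%:R]natrD !natrM.
  set s := (\sum_(_ <= _ < _) p _)%N.
  move: hp.
  under eq_bigr => i _ do rewrite ceil_third -pmulrn.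
  rewrite -mulr_sumr sumrB -mulr_suml -!natr_sum -/A -/s => h.
  lra.
(* One more than the number of vertices in the block coloring. *)
exists (p 1 + A')%N; split; last first.
  under eq_bigr => i _ do rewrite ceil_third.
  rewrite -(big_morph Posz PoszD (erefl 0%:Z)) -/A -AA'; lia.
split; first by lia.
- apply: pm_arrows_of_counts => //; first by lia.
  + by move=> i; apply: p_noninc.
  + by rewrite (sumE (fun i => (p i + 2) %/ 3)%N) -/A -AA'; lia.
  + rewrite sumE; move: hpN AA'; move: (bigop _ _ _) => s; lia.
- move=> k _ kr; rewrite leqNgt; apply/negP => /ltn_RPM_blocks; apply=> //.
  + by lia.
  + by move=> i /andP[i1 ir]; have := p2 i; rewrite ir andbT; lia.
  + by lia.
Qed.
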